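(* Let $\mathbb P$ be a partition, $P_0$ a probability on $\mathcal A(\mathbb P)$, and let $a\in\mathbb R$, $b>0$ satisfy $0\le a+b\le 1$ and $a\le 0$; put $c=1-(a+b)$. Let $(\underline P,\overline P)$ be the Vertical Barrier Model given by $$\underline P(A)=\max\{bP_0(A)+a,0\}\ \ \forall A\in\mathcal A(\mathbb P)\setminus\{\Omega\},\qquad \underline P(\Omega)=1,$$ $$\overline P(A)=\min\{bP_0(A)+c,1\}\ \ \forall A\in\mathcal A(\mathbb P)\setminus\{\emptyset\},\qquad \overline P(\emptyset)=0.$$ Then $\underline P$ is a coherent lower probability and $\overline P$ is a coherent upper probability on $\mathcal A(\mathbb P)$. Further, $\underline P$ is 2-monotone and $\overline P$ is 2-alternating.
   Context: A partition $\mathbb P$ is an arbitrary (finite or infinite) set of pairwise disjoint non-impossible events (atoms) whose logical sum is the sure event $\Omega$. $\mathcal A(\mathbb P)$ is the powerset of $\mathbb P$ (events are identified with sets of atoms); $\emptyset$ is the impossible event, and $\vee,\wedge,\neg$ are union, intersection, complement. A probability on $\mathcal A(\mathbb P)$ is a finitely additive function $P_0:\mathcal A(\mathbb P)\to[0,1]$ with $P_0(\Omega)=1$ (no countable additivity is required). $I_A$ is the indicator of $A$; maxima of gains are over atoms; $\mathbb N$ includes $0$. $\underline P:\mathcal A(\mathbb P)\to\mathbb R$ is a coherent lower probability if for all $n\in\mathbb N$, $s_i\ge 0$, $A_i\in\mathcal A(\mathbb P)$ ($i=0,\dots,n$), $\max\big[\sum_{i=1}^n s_i(I_{A_i}-\underline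 P(A_i))-s_0(I_{A_0}-\underline P(A_0))\big]\ge 0$. $\overline P:\mathcal A(\mathbb P)\to\mathbb R$ is a coherent upper probability if for all $n\in\mathbb N$, $s_i\ge 0$, $A_i\in\mathcal A(\mathbb P)$ ($i=0,\dots,n$), $\max\big[\sum_{i=1}^n s_i(\overline P(A_i)-I_{A_i})-s_0(\overline P(A_0)-I_{A_0})\big]\ge 0$. $\underline P$ is 2-monotone if $\underline P(A\vee B)\ge\underline P(A)+\underline P(B)-\underline P(A\wedge B)$ for all $A,B\in\mathcal A(\mathbb P)$; $\overline P$ is 2-alternating if $\overline P(A\vee B)\le\overline P(A)+\overline P(B)-\overline P(A\wedge B)$ for all $A,B\in\mathcal A(\mathbb P)$. *)

(* Defs.v *)
From mathcomp Require Import all_boot all_order all_algebra.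
From mathcomp Require Import classical_sets boolp reals numfun.

Set Implicit Arguments.
Unset Strict Implicit.
Unset Printing Implicit Defensive.

Import Order.TTheory GRing.Theory Num.Theory.

Local Open Scope classical_set_scope.
Local Open Scope ring_scope.

(* A partition is represented by the type [T] of its atoms and an event by the
   set of atoms included in it, so that the powerset of the partition is
   [set T], the sure event is [setT] and the impossible event is [set0].
   [T] is an arbitrary type; a probability exists only if it is inhabited. *)

Record finitely_additive_probability (R : realType) (T : Type)
    (P0 : set T -> R) : Prop := FinitelyAdditiveProbability {
  fap_ge0 : forall A : set T, 0 <= P0 A ;
  fap_le1 : forall A : set T, P0 A <= 1 ;
  fap_setT : P0 setT = 1 ;
  fap_additive : forall A B : set T,
    A `&` B = set0 -> P0 (A `|` B) = P0 A + P0 B }.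

Definition is_maximum (R : realType) (T : Type) (G : T -> R) (m : R) : Prop :=
  range G m /\ ubound (range G) m.

(* The gains below take finitely many values, so on a nonempty [T] they do
   attain a maximum. *)
Definition coherent_lower (R : realType) (T : Type) (lP : set T -> R) : Prop :=
  forall (n : nat) (s : nat -> R) (A : nat -> set T),
    (forall i, (i <= n)%N -> 0 <= s i) ->
    exists2 m, is_maximum (fun w : T =>
      \sum_(1 <= i < n.+1) s i * (\1_(A i) w - lP (A i))
        - s 0%N * (\1_(A 0%N) w - lP (A 0%N))) m & 0 <= m.

Definition coherent_upper (R : realType) (T : Type) (uP : set T -> R) : Prop :=
  forall (n : nat) (s : nat -> R) (A : nat -> set T),
    (forall i, (i <= n)%N -> 0 <= s i) ->
    exists2 m, is_maximum (fun w : T =>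
      \sum_(1 <= i < n.+1) s i * (uP (A i) - \1_(A i) w)
        - s 0%N * (uP (A 0%N) - \1_(A 0%N) w)) m & 0 <= m.

Definition two_monotone (R : realType) (T : Type) (lP : set T -> R) : Prop :=
  forall A B : set T, lP (A `|` B) >= lP A + lP B - lP (A `&` B).

Definition two_alternating (R : realType) (T : Type) (uP : set T -> R) : Prop :=
  forall A B : set T, uP (A `|` B) <= uP A + uP B - uP (A `&` B).

Definition vbm_lower (R : realType) (T : Type) (P0 : set T -> R) (a b : R)
    (A : set T) : R :=
  if `[< A = setT >] then 1 else Num.max (b * P0 A + a) 0.

Definition vbm_upper (R : realType) (T : Type) (P0 : set T -> R) (b c : R)
    (A : set T) : R :=
  if `[< A = set0 >] then 0 else Num.min (b * P0 A + c) 1.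

(* Main.v *)
Require Import Defs.
From mathcomp Require Import all_boot all_order all_algebra.
From mathcomp Require Import classical_sets boolp reals numfun.
From mathcomp Require Import lra.

(** The two assertions on the upper probability follow from those on the lower
    one by conjugacy: [uP A = 1 - lP (~` A)].

    Two-monotonicity is an equality if one of the two events is sure.  Otherwise
    it holds because [x |-> max (b x + a) 0] is convex and [P0] is modular: the
    sure event can then occur only as the union, on the larger side of the
    inequality, where raising its value from [b + a <= 1] to 1 does no harm.

    Coherence of [lP] is the easy half of the envelope theorem: it suffices to
    find, for every event [A0], a finitely additive probability [Q >= lP] with
    [Q A0 = lP A0], since the [Q]-expectation of the gain is then nonnegative,
    and a maximum is at least the expectation.  For this model no extension
    theorem is needed, because [Q] can be written down.  For [A0 <> setT] pick
    an atom [x] outside [A0] and put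

      [Q A = k P0 (A `&` A0) + l P0 (A `\` A0) + c 1_A(x)],  [0 <= k, l <= b].

    Then [Q <= b P0 + c], which applied to complements says [Q >= b P0 + a], so
    that [Q] dominates [lP].  The two numbers [k] and [l] are left free to
    adjust [Q A0] to [lP A0] and [Q setT] to 1; they exist because [lP A0] lies
    between 0 and [b P0 A0], and [1 - c - lP A0] between 0 and
    [b P0 (~` A0)].  When [A0 = setT], any dominating [Q] will do. *)

Set Implicit Arguments.
Unset Strict Implicit.
Unset Printing Implicit Defensive.

Import Order.TTheory GRing.Theory Num.Theory.
Local Open Scope classical_set_scope.
Local Open Scope ring_scope.

(** * Finitely additive probabilities *)

Section FinitelyAdditive.
Context {R : realType} {T : Type}.
Implicit Types (Q : set T -> R) (A B : set T).

Lemma fap_split Q (hQ : finitely_additive_probability Q) A B :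
  Q A = Q (A `&` B) + Q (A `\` B).
Proof.
rewrite -(fap_additive hQ) ?setUIDK //.
by rewrite setDE setIACA setICr setI0.
Qed.

Lemma fap_set0 Q (hQ : finitely_additive_probability Q) : Q set0 = 0.
Proof. by have := fap_additive hQ (setI0 set0); rewrite setU0; lra. Qed.

Lemma fap_setC Q (hQ : finitely_additive_probability Q) A : Q (~` A) = 1 - Q A.
Proof.
by have := fap_split hQ setT A; rewrite (fap_setT hQ) setTI setTD; lra.
Qed.

Lemma fap_setU Q (hQ : finitely_additive_probability Q) A B :
  Q (A `|` B) = Q A + Q B - Q (A `&` B).
Proof.
have := fap_split hQ (A `|` B) B; have := fap_split hQ A B.
by rewrite (setIidr (@subsetUr _ A B)) setDUl setDv setU0; lra.
Qed.

Lemma fap_setI_le Q (hQ : finitely_additive_probability Q) A B :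
  Q (A `&` B) <= Q A.
Proof. by have := fap_split hQ A B; have := fap_ge0 hQ (A `\` B); lra. Qed.

Lemma fap_inhabited Q (hQ : finitely_additive_probability Q) : inhabited T.
Proof.
have [T0|/set0P[x _]] := eqVneq [set: T] set0; last exact: inhabits x.
by have := fap_setT hQ; rewrite T0 (fap_set0 hQ); lra.
Qed.

Lemma fap_of_ge0 Q :
    (forall A, 0 <= Q A) -> Q setT = 1 ->
    (forall A B, A `&` B = set0 -> Q (A `|` B) = Q A + Q B) ->
  finitely_additive_probability Q.
Proof.
move=> Q0 QT QU; split=> // A.
by have := QU _ _ (setICr A); rewrite setUv QT; have := Q0 (~` A); lra.
Qed.

Lemma indic_setU A B (x : T) : A `&` B = set0 ->
  \1_(A `|` B) x = \1_A x + \1_B x :> R.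
Proof.
move=> AB0; rewrite !indicE in_setU.
have [xA|_] := boolP (x \in A); have [xB|_] := boolP (x \in B) => /=; try lra.
suff: set0 x by [].
by rewrite -AB0; split; apply: set_mem.
Qed.

(** Monotonicity of the expectation of simple functions, without an integral.
    Localizing to an event [B] makes the induction go through: splitting [B]
    along the last event turns its indicator into a constant on each part. *)
Lemma fap_sum_le_in Q (hQ : finitely_additive_probability Q)
    (d : nat -> R) (A : nat -> set T) n (B : set T) (M : R) :
    (forall w, B w -> \sum_(i < n) d i * \1_(A i) w <= M) ->
  \sum_(i < n) d i * Q (A i `&` B) <= M * Q B.
Proof.
elim: n B M => [|n IHn] B M dM.
  rewrite big_ord0; have [->|/set0P[w Bw]] := eqVneq B set0.
    by rewrite (fap_set0 hQ) mulr0.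
  by rewrite mulr_ge0 ?(fap_ge0 hQ) //; have := dM w Bw; rewrite big_ord0.
have inA : \sum_(i < n) d i * Q (A i `&` (B `&` A n))
    <= (M - d n) * Q (B `&` A n).
  apply: IHn => w [Bw Aw]; have := dM w Bw.
  by rewrite big_ord_recr /= (indicE _ (A n)) mem_set //=; lra.
have outA : \sum_(i < n) d i * Q (A i `&` (B `\` A n)) <= M * Q (B `\` A n).
  apply: IHn => w [Bw Aw]; have := dM w Bw.
  by rewrite big_ord_recr /= (indicE _ (A n)) memNset //=; lra.
rewrite big_ord_recr /= (setIC (A n)) (fap_split hQ B (A n)).
have -> : \sum_(i < n) d i * Q (A i `&` B) =
    \sum_(i < n) d i * Q (A i `&` (B `&` A n)) +
    \sum_(i < n) d i * Q (A i `&` (B `\` A n)).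
  rewrite -big_split; apply: eq_bigr => i _ /=.
  by rewrite (fap_split hQ (A i `&` B) (A n)) setIA setIDA mulrDr.
by lra.
Qed.

Lemma fap_sum_le Q (hQ : finitely_additive_probability Q)
    (d : nat -> R) (A : nat -> set T) n (M : R) :
    (forall w, \sum_(i < n) d i * \1_(A i) w <= M) ->
  \sum_(i < n) d i * Q (A i) <= M.
Proof.
move=> dM; have := @fap_sum_le_in Q hQ d A n setT M (fun w _ => dM w).
rewrite (fap_setT hQ) mulr1; congr (_ <= _).
by apply: eq_bigr => i _; rewrite setIT.
Qed.

End FinitelyAdditive.

(** * Coherence from dominating probabilities *)

Section Coherence.
Context {R : realType} {T : Type}.

Lemma is_maximum_fin (I : finType) (h : T -> I) (F : I -> R) (x0 : T) :
  exists m, is_maximum (F \o h) m.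
Proof.
have hx0 : `[< exists w, h w = h x0 >] by apply/asboolP; exists x0.
case: (arg_maxP (P := fun i => `[< exists w, h w = i >]) F hx0).
move=> i /asboolP[w <-] maxF.
exists (F (h w)); split=> [|_ [v _ <-]]; first by exists w.
by apply: maxF; apply/asboolP; exists v.
Qed.

(** A gain depends on an atom only through which of the finitely many events
    occur there. *)
Lemma is_maximum_simple (x0 : T) n (F : (nat -> R) -> R) (A : nat -> set T) :
    (forall u v, (forall i, (i <= n)%N -> u i = v i) -> F u = F v) ->
  exists m, is_maximum (fun w => F (fun i => \1_(A i) w)) m.
Proof.
move=> Fext.
pose h w : {ffun 'I_n.+1 -> bool} := [ffun i : 'I_n.+1 => w \in A i].
pose F' (e : {ffun 'I_n.+1 -> bool}) := F (fun i => (e (inord i))%:R).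
have -> : (fun w => F (fun i => \1_(A i) w)) = F' \o h.
  apply/funext => w; apply: Fext => i le_in.
  by rewrite indicE ffunE inordK.
exact: is_maximum_fin.
Qed.

(** If the gain were bounded by [m < 0], so would be its expectation under the
    probability [Q] that is tight at the event [A 0], yet no term of that
    expectation is negative. *)
Lemma coherent_lower_envelope (lP : set T -> R) (x0 : T) :
    (forall A0, exists Q, [/\ finitely_additive_probability Q,
       forall A, lP A <= Q A & Q A0 = lP A0]) ->
  coherent_lower lP.
Proof.
move=> env n s A s_ge0.
have [|m Gm] := @is_maximum_simple x0 n (fun u : nat -> R =>
    \sum_(1 <= i < n.+1) s i * (u i - lP (A i)) - s 0%N * (u 0%N - lP (A 0%N)))
    A.
  move=> u v uv; rewrite uv //; congr (_ - _).
  by apply: eq_big_nat => i /andP[_ lt_in]; rewrite uv.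
exists m => //; have [Q [hQ leQ Q0]] := env (A 0%N).
(* Absorb the sign of the bet against [A 0] into the coefficients. *)
pose d i := if i == 0%N then - s i else s i.
have gainE (u : nat -> R) :
    \sum_(1 <= i < n.+1) s i * (u i - lP (A i)) - s 0%N * (u 0%N - lP (A 0%N))
    = \sum_(i < n.+1) d i * u i - \sum_(i < n.+1) d i * lP (A i).
  rewrite -sumrB -(big_mkord xpredT (fun i => d i * u i - d i * lP (A i))).
  rewrite big_ltn // addrC; congr (_ + _); first by rewrite /d /=; lra.
  by apply: eq_big_nat => -[|i] // _; rewrite /d /= mulrBr.
have EG : \sum_(i < n.+1) d i * Q (A i) <= m + \sum_(i < n.+1) d i * lP (A i).
  apply: (fap_sum_le hQ) => w; have := Gm.2 _ (imageT _ w).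
  by rewrite (gainE (fun i => \1_(A i) w)); lra.
have := gainE (fun i => Q (A i)); rewrite /= Q0 subrr mulr0 subr0 => E.
have : 0 <= \sum_(1 <= i < n.+1) s i * (Q (A i) - lP (A i)).
  rewrite big_nat_cond; apply: sumr_ge0 => i /andP[/andP[_ lt_in] _].
  by rewrite mulr_ge0 ?s_ge0 // subr_ge0.
by lra.
Qed.

End Coherence.

(** * Conjugacy *)

Section Conjugacy.
Context {R : realType} {T : Type} {lP uP : set T -> R}.

(** Betting against [A] at price [uP A] is betting on [~` A] at price
    [lP (~` A)]. *)
Lemma coherent_upper_conj : (forall A, uP A = 1 - lP (~` A)) ->
  coherent_lower lP -> coherent_upper uP.
Proof.
move=> conj coh n s A s_ge0; have := coh n s (fun i => ~` A i) s_ge0.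
have gainC i w : uP (A i) - \1_(A i) w = \1_(~` A i) w - lP (~` A i).
  by rewrite conj !indicE in_setC; case: (w \in A i) => /=; lra.
case=> m Gm m0; exists m => //; move: Gm; congr (is_maximum _ m).
apply/funext => w.
by rewrite gainC; congr (_ - _); apply: eq_bigr => i _; rewrite gainC.
Qed.

Lemma two_alternating_conj : (forall A, uP A = 1 - lP (~` A)) ->
  two_monotone lP -> two_alternating uP.
Proof.
move=> conj mono A B; have := mono (~` A) (~` B).
by rewrite !conj setCU setCI; lra.
Qed.

End Conjugacy.

(** * The Vertical Barrier Model *)

Lemma exists_factor (R : realType) (b p t : R) :
  0 <= t -> t <= b * p -> 0 <= p -> 0 <= b ->
  exists k, [/\ 0 <= k, k <= b & k * p = t].
Proof.
move=> t0 tb; rewrite le_eqVlt => /predU1P[p0|p0] b0.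
  by exists 0; split=> //; move: tb; rewrite -p0 mulr0; lra.
exists (t / p); rewrite ler_pdivrMr // divfK ?gt_eqF //.
by split=> //; rewrite divr_ge0 // ltW.
Qed.

Section VerticalBarrier.
Context {R : realType} {T : Type} {P0 : set T -> R} {a b c : R}.
Implicit Types A B : set T.

Lemma vbm_lowerT : vbm_lower P0 a b setT = 1.
Proof. by rewrite /vbm_lower asboolT. Qed.

Lemma vbm_lowerE A : A <> setT ->
  vbm_lower P0 a b A = Num.max (b * P0 A + a) 0.
Proof. by move=> AT; rewrite /vbm_lower asboolF. Qed.

Lemma vbm_lower_ge (hP0 : finitely_additive_probability P0) (hab1 : a + b <= 1)
  A : Num.max (b * P0 A + a) 0 <= vbm_lower P0 a b A.
Proof.
have [->|AT] := pselect (A = setT); last by rewrite vbm_lowerE.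
by rewrite vbm_lowerT ge_max ler01 andbT (fap_setT hP0) mulr1; lra.
Qed.

Lemma vbm_conj (hP0 : finitely_additive_probability P0)
    (hc : c = 1 - (a + b)) A :
  vbm_upper P0 b c A = 1 - vbm_lower P0 a b (~` A).
Proof.
rewrite /vbm_upper; case: asboolP => [->|A0].
  by rewrite setC0 vbm_lowerT subrr.
rewrite vbm_lowerE; last by rewrite -setC0 => /setC_inj.
rewrite (fap_setC hP0) mulrBr mulr1.
by case: (leP (_ + c)); case: (leP (_ + a)); lra.
Qed.

(** With [p], [q] the probabilities of [A], [B] and [r] that of the
    intersection, the union has probability [p + q - r] and [r <= p, q], so
    convexity of [g x = max (b x + a) 0] gives
    [g p + g q <= g r + g (p + q - r)].  If the union is the sure event, its
    lower probability 1 is at least [g 1]. *)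
Lemma two_monotone_vbm (hP0 : finitely_additive_probability P0)
    (hb : 0 <= b) (hab1 : a + b <= 1) :
  two_monotone (vbm_lower P0 a b).
Proof.
move=> A B.
have [->|AT] := pselect (A = setT); first by rewrite setTU setTI; lra.
have [->|BT] := pselect (B = setT); first by rewrite setUT setIT; lra.
apply: le_trans (vbm_lower_ge hP0 hab1 _).
rewrite (vbm_lowerE AT) (vbm_lowerE BT) vbm_lowerE; last first.
  by move=> ABT; apply: AT; apply/seteqP; split=> // x _;
     have [] : (A `&` B) x by rewrite ABT.
rewrite (fap_setU hP0) mulrBr mulrDr.
have IA : b * P0 (A `&` B) <= b * P0 A.
  by rewrite ler_wpM2l // (fap_setI_le hP0).
have IB : b * P0 (A `&` B) <= b * P0 B.
  by rewrite ler_wpM2l // setIC (fap_setI_le hP0).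
by do 4![case: (leP (_ + a) 0) => ?]; lra.
Qed.

(** The bound on the complement reads [1 - Q A <= b (1 - P0 A) + c], which is
    [b P0 A + a <= Q A]. *)
Lemma vbm_lower_le (hc : c = 1 - (a + b)) (Q : set T -> R) :
    finitely_additive_probability P0 -> finitely_additive_probability Q ->
    (forall A, Q A <= b * P0 A + c) ->
  forall A, vbm_lower P0 a b A <= Q A.
Proof.
move=> hP0 hQ leQ A; have [->|AT] := pselect (A = setT).
  by rewrite vbm_lowerT (fap_setT hQ).
rewrite vbm_lowerE // ge_max (fap_ge0 hQ) andbT.
have := leQ (~` A); rewrite !fap_setC // mulrBr mulr1.
by lra.
Qed.

(** The excess mass [c] sits at an atom [x] outside [A0], so that it does not
    contribute to [Q A0]; rescaling [P0] separately on [A0] and on its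
    complement, by factors that do not exceed [b], then fixes both [Q A0] and
    the total mass. *)
Lemma vbm_tight_probability (hP0 : finitely_additive_probability P0)
    (hb : 0 <= b) (hab0 : 0 <= a + b) (hab1 : a + b <= 1) (ha : a <= 0)
    (hc : c = 1 - (a + b)) A0 :
  A0 <> setT ->
  exists Q, [/\ finitely_additive_probability Q,
    forall A, vbm_lower P0 a b A <= Q A & Q A0 = vbm_lower P0 a b A0].
Proof.
move=> A0T; set t := vbm_lower P0 a b A0.
have [x /= A0x] : (~` A0) !=set0.
  by apply/set0P/eqP => A00; apply: A0T; rewrite -(setCK A0) A00 setC0.
have [t0 tb ta tab] :
    [/\ 0 <= t, t <= b * P0 A0, b * P0 A0 + a <= t & t <= a + b].
  have P0_ge0 : 0 <= b * P0 A0 by rewrite mulr_ge0 ?(fap_ge0 hP0).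
  have P0_le1 : b * P0 A0 <= b by rewrite ler_piMr ?(fap_le1 hP0).
  by rewrite /t vbm_lowerE //; case: (leP (b * P0 A0 + a) 0) => ?; split; lra.
have [k [k0 kb kt]] := exists_factor t0 tb (fap_ge0 hP0 A0) hb.
have [l [l0 lb lt]] :
    exists l, [/\ 0 <= l, l <= b & l * P0 (~` A0) = a + b - t].
  by apply: exists_factor; rewrite ?(fap_ge0 hP0) // ?(fap_setC hP0); lra.
have c0 : 0 <= c by lra.
pose Q A := k * P0 (A `&` A0) + l * P0 (A `\` A0) + c * \1_A x.
have hQ : finitely_additive_probability Q.
  apply: fap_of_ge0 => [A||A B AB0]; rewrite /Q.
  - by rewrite !addr_ge0 // mulr_ge0 // ?(fap_ge0 hP0) // indicE ler0n.
  - by rewrite setTI setTD kt lt indicE in_setT /=; lra.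
  rewrite setIUl setDUl !(fap_additive hP0) ?indic_setU //; first by lra.
    by rewrite !setDE setIACA AB0 set0I.
  by rewrite setIACA AB0 set0I.
exists Q; split=> //; last first.
  rewrite /Q setIid setDv (fap_set0 hP0) kt indicE memNset //=.
  by lra.
apply: (vbm_lower_le hc) => // A.
rewrite /Q (fap_split hP0 A A0) mulrDr.
rewrite !lerD // ?ler_wpM2r ?(fap_ge0 hP0) //.
by rewrite ler_piMr // indicE lern1 leq_b1.
Qed.

Lemma coherent_lower_vbm (hP0 : finitely_additive_probability P0)
    (hb : 0 <= b) (hab0 : 0 <= a + b) (hab1 : a + b <= 1) (ha : a <= 0)
    (hc : c = 1 - (a + b)) :
  coherent_lower (vbm_lower P0 a b).
Proof.
have [x0] := fap_inhabited hP0.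
apply: (coherent_lower_envelope x0) => A0.
have [->|] := pselect (A0 = setT); last exact: vbm_tight_probability.
(* Tightness at the sure event is automatic, so any dominating [Q] serves. *)
have [|Q [hQ leQ _]] :=
  vbm_tight_probability hP0 hb hab0 hab1 ha hc (A0 := set0).
  by move/seteqP=> [_ /(_ x0 I)].
by exists Q; split=> //; rewrite (fap_setT hQ) vbm_lowerT.
Qed.

End VerticalBarrier.

Theorem proposition4p1 (R : realType) (T : Type) (P0 : set T -> R) (a b c : R)
    (hP0 : finitely_additive_probability P0)
    (hb : 0 < b) (hab0 : 0 <= a + b) (hab1 : a + b <= 1) (ha : a <= 0)
    (hc : c = 1 - (a + b)) :
  [/\ coherent_lower (vbm_lower P0 a b),
      coherent_upper (vbm_upper P0 b c),
      two_monotone (vbm_lower P0 a b)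
    & two_alternating (vbm_upper P0 b c)].
Proof.
have coh := coherent_lower_vbm hP0 (ltW hb) hab0 hab1 ha hc.
have mono := two_monotone_vbm hP0 (ltW hb) hab1.
have conj := vbm_conj hP0 hc.
split=> //; first exact: coherent_upper_conj conj coh.
exact: two_alternating_conj conj mono.
Qed.
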